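(* For any cycle $C_n$ of order $n\geq 3$, $\gamma_{\times 2R}(C_n)=2\left\lceil\frac{2n}{3}\right\rceil$.
   Context: For a finite simple graph $G=(V,E)$ with minimum degree at least $1$, a Roman $2$-tuple dominating function on $G$ is a function $f\colon V\to\{0,1,2\}$ such that every vertex $v$ with $f(v)=0$ has at least $2$ neighbors $w$ with $f(w)=2$, and every vertex $v$ with $f(v)\neq 0$ has at least $1$ neighbor $w$ with $f(w)=2$. The weight of $f$ is $f(V)=\sum_{v\in V}f(v)$, and $\gamma_{\times 2R}(G)$ is the minimum weight of a Roman $2$-tuple dominating function on $G$. *)

(* Defs.v *)
From HB Require Import structures.
From mathcomp Require Import all_boot all_order all_algebra.

Set Implicit Arguments.
Unset Strict Implicit.
Unset Printing Implicit Defensive.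

Record sgraph := SGraph {
  vertex :> finType;
  adj : rel vertex;
  adj_sym : symmetric adj;
  adj_irr : irreflexive adj
}.

Definition min_degree_ge1 (G : sgraph) : Prop :=
  forall v : G, 0 < #|[set w | adj v w]|.

Section RomanTwoTuple.

Variable G : sgraph.

Definition nbrs2 (f : {ffun G -> 'I_3}) (v : G) : {set G} :=
  [set w | adj v w & f w == 2 :> nat].

Definition roman2tuple (f : {ffun G -> 'I_3}) : bool :=
  [forall v, if f v == 0 :> nat then 2 <= #|nbrs2 f v| else 1 <= #|nbrs2 f v|].

Definition weight (f : {ffun G -> 'I_3}) : nat := \sum_(v : G) f v.

(* The seed of the arg min is the constant function 2.  It is admissible
   exactly when the minimum degree is at least 1; only then is this number
   meaningful, see [gamma_x2RP]. *)
Definition gamma_x2R : nat :=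
  weight [arg min_(f < [ffun=> ord_max] | roman2tuple f) weight f].

Lemma roman2tuple_const2 :
  min_degree_ge1 G -> roman2tuple [ffun=> ord_max].
Proof.
move=> dG; apply/forallP => v; rewrite ffunE /=.
suff -> : nbrs2 [ffun=> ord_max] v = [set w | adj v w] by apply: dG.
by apply/setP => w; rewrite !inE ffunE /= andbT.
Qed.

Lemma gamma_x2RP : min_degree_ge1 G ->
  (exists2 f, roman2tuple f & weight f = gamma_x2R) /\
  (forall f, roman2tuple f -> gamma_x2R <= weight f).
Proof.
move=> /roman2tuple_const2 c2; rewrite /gamma_x2R.
by case: arg_minnP => // f Pf minf; split=> //; exists f.
Qed.

End RomanTwoTuple.

(* [ordS i] is the successor of [i] modulo [n].  The conjunct [i != j] only
   matters for [n = 1], where it removes the loop. *)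
Definition cycle_adj n : rel 'I_n :=
  fun i j => (i != j) && ((j == ordS i) || (i == ordS j)).

Lemma cycle_adj_sym n : symmetric (@cycle_adj n).
Proof. by move=> i j; rewrite /cycle_adj eq_sym orbC. Qed.

Lemma cycle_adj_irr n : irreflexive (@cycle_adj n).
Proof. by move=> i; rewrite /cycle_adj eqxx. Qed.

Definition cycle_graph n : sgraph :=
  SGraph (@cycle_adj_sym n) (@cycle_adj_irr n).

Lemma cycle_graph_min_degree n : 2 <= n -> min_degree_ge1 (cycle_graph n).
Proof.
move=> n2 v; apply/card_gt0P; exists (ordS v); rewrite inE /= /cycle_adj eqxx andbT.
apply/negP => /eqP /(congr1 val) /=.
have := ltn_ord v; rewrite leq_eqVlt => /orP[/eqP e|lt].
  by rewrite e modnn => v0; rewrite v0 in e; rewrite -e in n2.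
by rewrite modn_small // => /n_Sn.
Qed.

(* Main.v *)
(** Let [s v] be the sum of [f] over the closed neighbourhood of [v]; then [s]
    sums to three times the weight [W], and [s v >= 4] everywhere, so
    [3 W >= 4 n].  If [f] omits the value 1 then [W] is even, and
    [W >= 2 * ceil (2 n / 3)] follows.  If [f] takes the value 1 then [s >= 5] at
    two vertices at least, so [3 W >= 4 n + 2], which gives the same bound.
    Equality is attained by the pattern 2, 2, 0, 2, 2, 0, ..., truncated at
    length [n]. *)
Require Import Defs.
From mathcomp Require Import all_boot all_order all_algebra.
From mathcomp Require Import zify lra.

Import GRing.Theory Num.Theory.

Lemma val_ordS n (i : 'I_n) : ordS i = (if i.+1 == n then 0 else i.+1) :> nat.
Proof.
rewrite /=; case: eqP => [->|/eqP ne]; first exact: modnn.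
by rewrite modn_small // ltn_neqAle ne ltn_ord.
Qed.

Lemma val_ord_pred n (i : 'I_n) :
  ord_pred i = (if i == 0 :> nat then n.-1 else i.-1) :> nat.
Proof.
have lt_in := ltn_ord i; rewrite /=; case: eqP => [->|/eqP i0].
  by rewrite add0n modn_small // prednK // (leq_ltn_trans _ lt_in).
rewrite -subn1 -addnBAC ?lt0n // subn1 modnDr modn_small //.
exact: leq_ltn_trans (leq_pred _) lt_in.
Qed.

Lemma ordS_neq_pred n (i : 'I_n) : 3 <= n -> ordS i != ord_pred i.
Proof.
move=> n3; rewrite -(inj_eq (@ord_inj n)) val_ordS val_ord_pred.
have := ltn_ord i; case: (i.+1 == n) / eqP; case: (i == 0 :> nat) / eqP; lia.
Qed.

Lemma cycle_adjE n (i j : 'I_n) : 2 <= n ->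
  cycle_adj i j = (j \in [set ordS i; ord_pred i]).
Proof.
move=> n2; rewrite !inE /cycle_adj (eq_sym i (ordS j)).
rewrite (can2_eq (@ordSK n) (@ord_predK n)).
case: (eqVneq i j) => [<-|//] /=.
rewrite -!(inj_eq (@ord_inj n)) val_ordS val_ord_pred.
have := ltn_ord i; case: (i.+1 == n) / eqP; case: (i == 0 :> nat) / eqP; lia.
Qed.

Lemma card_nbrs2_cycle n (f : {ffun cycle_graph n -> 'I_3}) (v : 'I_n) :
  3 <= n ->
  #|nbrs2 f v| = (f (ordS v) == 2 :> nat) + (f (ord_pred v) == 2 :> nat).
Proof.
move=> n3; rewrite -sum1_card.
transitivity (\sum_(w in [set ordS v; ord_pred v]) (f w == 2 :> nat)).
  rewrite [RHS]big_mkcond [LHS]big_mkcond; apply: eq_bigr => w _.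
  rewrite inE /= cycle_adjE ?(ltnW n3) //.
  by case: (w \in _); case: eqP.
by rewrite big_setU1 ?big_set1 // inE ordS_neq_pred.
Qed.

(** Both demands, two at a zero and one elsewhere, merge into [(f v == 0).+1], a form that [lia] can
    use. *)
Lemma roman2tuple_cycleP n (f : {ffun cycle_graph n -> 'I_3}) : 3 <= n ->
  reflect (forall v : 'I_n, (f v == 0 :> nat).+1 <=
             (f (ordS v) == 2 :> nat) + (f (ord_pred v) == 2 :> nat))
          (roman2tuple f).
Proof.
move=> n3; apply: (iffP forallP) => h v; have := h v;
  by rewrite card_nbrs2_cycle //; case: (f v == 0 :> nat).
Qed.

Definition nbhd_sum {n} (f : 'I_n -> 'I_3) (v : 'I_n) : nat :=
  f (ord_pred v) + f v + f (ordS v).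

Lemma sum_nbhd_sum n (f : 'I_n -> 'I_3) :
  \sum_v nbhd_sum f v = 3 * \sum_v f v.
Proof.
have shift (h : 'I_n -> 'I_n) : injective h ->
    \sum_v f (h v) = \sum_v f v :> nat.
  by move=> inj_h; rewrite [RHS](reindex_inj inj_h).
rewrite !big_split /= (shift _ (@ordS_inj n)) (shift _ (@ord_pred_inj n)).
by rewrite !mulSn addn0 addnA.
Qed.

Section LowerBound.

Variables (n : nat) (f : 'I_n -> 'I_3).
Hypothesis romanf : forall v, (f v == 0 :> nat).+1 <=
  (f (ordS v) == 2 :> nat) + (f (ord_pred v) == 2 :> nat).

(** A zero has two neighbours of value 2, and a 2 has one. A 1 has one too, and its other neighbour
    is nonzero, since a zero tolerates no neighbour of value 1. *)
Lemma nbhd_sum_ge4 v : 4 <= nbhd_sum f v.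
Proof.
have := romanf v; have := romanf (ordS v); have := romanf (ord_pred v).
rewrite /nbhd_sum ordSK ord_predK; lia.
Qed.

(* A vertex of value 1 has no neighbour of value 0, so the cycle reads
   2 2 1 1 2 2 around [v] and its successor. *)
Lemma two_large_nbhd_pair v : f v = 1 :> nat -> f (ordS v) = 1 :> nat ->
  exists u w, [/\ u != w, 5 <= nbhd_sum f u & 5 <= nbhd_sum f w].
Proof.
move=> v1 w1; exists (ord_pred v), (ordS (ordS v)).
have := romanf v; have := romanf (ord_pred v).
have := romanf (ordS v); have := romanf (ordS (ordS v)).
rewrite /nbhd_sum !ordSK !ord_predK => h1 h2 h3 h4.
split; [|lia|lia].
(* If the two witnesses coincided, both neighbours of that vertex would have value 1, and none the
   required 2. *)
apply/eqP => e; move: h1; rewrite -e ord_predK; lia.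
Qed.

(** No neighbour of [v] is 0, so either one of them is 1, which gives an adjacent pair of ones, or
    both are 2. *)
Lemma two_large_nbhd v : f v = 1 :> nat ->
  exists u w, [/\ u != w, 5 <= nbhd_sum f u & 5 <= nbhd_sum f w].
Proof.
move=> v1; have [s1|s1] := eqVneq (f (ordS v) : nat) 1.
  exact: (two_large_nbhd_pair _ v1 s1).
have [p1|p1] := eqVneq (f (ord_pred v) : nat) 1.
  by apply: (two_large_nbhd_pair _ p1); rewrite ord_predK.
(* The cycle reads 2 1 2 2 from the predecessor of [v]. *)
exists v, (ordS v).
have := romanf v; have := romanf (ord_pred v); have := romanf (ordS v).
rewrite /nbhd_sum !ordSK !ord_predK => h1 h2 h3.
have fS := ltn_ord (f (ordS v)); have fP := ltn_ord (f (ord_pred v)).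
split; [|lia|lia].
by apply/eqP => e; move: s1; rewrite -e v1.
Qed.

(** [n - n %/ 3] is the ceiling of [2 n / 3] written over the naturals; see [ceil_two_thirds]. *)
Lemma weight_cycle_lb : 2 * (n - n %/ 3) <= \sum_v f v.
Proof.
have sum4 : \sum_(v : 'I_n) 4 = n * 4 by rewrite sum_nat_const card_ord.
have [/existsP[v /eqP v1]|/existsPn no1] := boolP [exists v, f v == 1 :> nat].
  have [u [w [neq_uw u5 w5]]] := two_large_nbhd v v1.
  (* For [n = 3 q + r] the target is [4 q + 2 r], and [(4 r + 2) / 3] rounded up is at least [2 r]
     for [r <= 2]. *)
  suff : 4 * n + 2 <= 3 * \sum_v f v by lia.
  rewrite -sum_nbhd_sum -[4 * n]mulnC -sum4.
  have rest : \sum_(i | (i != u) && (i != w)) 4 <=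
              \sum_(i | (i != u) && (i != w)) nbhd_sum f i.
    by apply: leq_sum => i _; apply: nbhd_sum_ge4.
  have split_uw F : \sum_v F v =
      F u + (F w + \sum_(i | (i != u) && (i != w)) F i) :> nat.
    by rewrite (bigD1 u) //= (bigD1 w) 1?eq_sym.
  rewrite !split_uw; lia.
have : 4 * n <= 3 * \sum_v f v.
  rewrite -sum_nbhd_sum mulnC -sum4.
  by apply: leq_sum => v _; apply: nbhd_sum_ge4.
have -> : \sum_v f v = 2 * \sum_v (f v == 2 :> nat).
  rewrite big_distrr; apply: eq_bigr => v _ /=.
  by have := no1 v; have := ltn_ord (f v); lia.
lia.
Qed.

End LowerBound.

Definition roman_pattern n : {ffun cycle_graph n -> 'I_3} :=
  [ffun v : 'I_n => if v %% 3 == 2 then ord0 else ord_max].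

Lemma roman_patternE n (v : 'I_n) :
  roman_pattern n v = (if v %% 3 == 2 then 0 else 2) :> nat.
Proof. by rewrite ffunE; case: ifP. Qed.

(** Truncation does no harm at the seam: vertex 0 has value 2 and serves the last vertex, while
    vertex 1 serves vertex 0. *)
Lemma roman2tuple_pattern n : 3 <= n -> roman2tuple (roman_pattern n).
Proof.
move=> n3; apply/roman2tuple_cycleP => // v; rewrite !roman_patternE.
rewrite val_ordS val_ord_pred; have := ltn_ord v.
case: (v.+1 == n) / eqP; case: (v == 0 :> nat) / eqP;
  do !case: (_ %% 3 == 2) / eqP; lia.
Qed.

Lemma weight_pattern n : weight (roman_pattern n) = 2 * (n - n %/ 3).
Proof.
rewrite /weight (eq_bigr _ (fun v _ => roman_patternE n v)) /=.
elim: n => [|n IHn]; first by rewrite big_ord0.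
by rewrite big_ord_recr /= IHn; case: eqP; lia.
Qed.

Lemma gamma_x2R_cycle n : 3 <= n ->
  gamma_x2R (cycle_graph n) = 2 * (n - n %/ 3).
Proof.
move=> n3.
have [[f romanf wf] minf] := gamma_x2RP (cycle_graph_min_degree (ltnW n3)).
apply/eqP; rewrite eqn_leq -{1}weight_pattern minf ?roman2tuple_pattern //=.
by rewrite -wf; apply/weight_cycle_lb/roman2tuple_cycleP.
Qed.

Lemma ceil_two_thirds n :
  (Num.ceil (2 * n%:R / 3 : rat) = (n - n %/ 3)%:Z)%R.
Proof.
apply: ceil_def.
(* With [n = 3 q + r], the bounds defining the ceiling read
   [2 q + r - 1 < 2 q + 2 r / 3 <= 2 q + r], which follow from [0 <= r <= 2]. *)
have /(congr1 (fun k => k%:R : rat)%R) := divn_eq n 3.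
have r_ge0 := ler0n rat (n %% 3).
have : (n %% 3 <= 2)%N by rewrite -ltnS ltn_pmod.
rewrite -(ler_nat rat) intrB -!pmulrn natrB ?leq_div // natrD natrM.
lra.
Qed.

Theorem proposition6 (n : nat) (hn : (3 <= n)%N) :
  (Posz (gamma_x2R (cycle_graph n)) = 2 * Num.ceil (2 * n%:R / 3 : rat))%R.
Proof.
by rewrite gamma_x2R_cycle // ceil_two_thirds PoszM.
Qed.
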